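(* Let $B_{11}$ and $B_{12}$ be the two 18-vertex Blanuša snarks, given on vertex set $\{1,\dots,18\}$ by the edge sets $B_{11}$: $\{2,4\},\{3,4\},\{1,2\},\{1,5\},\{3,5\},\{6,8\},\{16,18\},\{16,17\},\{6,7\},\{2,7\},\{1,8\},\{4,9\},\{5,10\},\{11,15\},\{14,15\},\{12,14\},\{12,13\},\{11,13\},\{14,17\},\{13,16\},\{15,18\},\{8,9\},\{7,10\},\{9,11\},\{6,12\},\{3,18\},\{10,17\}$; $B_{12}$: $\{2,4\},\{3,4\},\{1,2\},\{1,5\},\{3,5\},\{3,6\},\{6,8\},\{8,18\},\{16,18\},\{16,17\},\{7,17\},\{6,7\},\{2,7\},\{1,8\},\{4,9\},\{9,12\},\{5,10\},\{10,11\},\{11,15\},\{14,15\},\{12,14\},\{12,13\},\{11,13\},\{14,17\},\{13,16\},\{15,18\},\{9,10\}$. For each $G \in \{B_{11}, B_{12}\}$, a $G$ design of order $n$ exists if and only if $n \equiv 1 \pmod{27}$.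
   Context: All graphs are simple. For a graph $G$, a $G$ design of order $n$ is a partition of the edge set of the complete graph $K_n$ into edge sets of subgraphs each isomorphic to $G$. By convention the empty set is a $G$ design of order $1$. *)

(* Defs.v *)
From mathcomp Require Import all_boot.

Set Implicit Arguments.
Unset Strict Implicit.
Unset Printing Implicit Defensive.

(* A finite simple graph whose vertices are taken from T: edges are 2-element
   sets of vertices, so there are no loops and no multiple edges. *)
Record sgraph (T : finType) := SGraph {
  vset : {set T};
  eset : {set {set T}};
  esetP : forall e, e \in eset -> e \subset vset /\ #|e| = 2
}.

Definition isomorphic (T U : finType) (G : sgraph T) (H : sgraph U) : Prop :=
  exists f : T -> U,
    [/\ {in vset G &, injective f},
        f @: vset G = vset H
      & {in vset G &, forall x y,
          ([set x; y] \in eset G) = ([set f x; f y] \in eset H)}].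

Definition subgraph (T : finType) (H K : sgraph T) : Prop :=
  vset H \subset vset K /\ eset H \subset eset K.

Lemma complete_esetP (n : nat) (e : {set 'I_n}) :
  e \in [set e : {set 'I_n} | #|e| == 2] -> e \subset [set: 'I_n] /\ #|e| = 2.
Proof. by rewrite inE => /eqP ->; rewrite subsetT. Qed.

Definition complete_graph (n : nat) : sgraph 'I_n :=
  SGraph (@complete_esetP n).

(* [partition] requires the blocks to be nonempty, pairwise disjoint and to
   cover the edges; for n = 1 the only such P is set0. *)
Definition is_design (T : finType) (G : sgraph T) (n : nat)
    (P : {set {set {set 'I_n}}}) : Prop :=
  partition P (eset (complete_graph n)) /\
  forall B, B \in P ->
    exists H : sgraph 'I_n,
      [/\ subgraph H (complete_graph n), isomorphic G H & B = eset H].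

Definition design_exists (T : finType) (G : sgraph T) (n : nat) : Prop :=
  exists P : {set {set {set 'I_n}}}, is_design G P.

(* The vertex set {1, ..., 18} is the set of nonzero elements of 'I_19, so that
   a vertex is equal, as a natural number, to its label. *)
Definition labels18 : {set 'I_19} := [set i : 'I_19 | 0 < i].

Definition edges_of (s : seq (nat * nat)) : {set {set 'I_19}} :=
  [set:: [seq [set inord p.1; inord p.2] | p <- s]].

Definition valid_pair (p : nat * nat) : bool :=
  [&& 0 < p.1 < 19, 0 < p.2 < 19 & p.1 != p.2].

Lemma edges_ofP (s : seq (nat * nat)) : all valid_pair s ->
  forall e, e \in edges_of s -> e \subset labels18 /\ #|e| = 2.
Proof.
move=> /allP vs e; rewrite inE => /mapP[[a b] /vs].
case/and3P=> /= /andP[a0 a19] /andP[b0 b19] neq_ab ->; split.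
  by rewrite subUset !sub1set !inE !inordK // a0 b0.
by rewrite cards2 -val_eqE /= !inordK // neq_ab.
Qed.

Definition B11_edges : seq (nat * nat) :=
  [:: (2,4); (3,4); (1,2); (1,5); (3,5); (6,8); (16,18); (16,17); (6,7);
      (2,7); (1,8); (4,9); (5,10); (11,15); (14,15); (12,14); (12,13); (11,13);
      (14,17); (13,16); (15,18); (8,9); (7,10); (9,11); (6,12); (3,18);
      (10,17)].

Definition B12_edges : seq (nat * nat) :=
  [:: (2,4); (3,4); (1,2); (1,5); (3,5); (3,6); (6,8); (8,18); (16,18);
      (16,17); (7,17); (6,7); (2,7); (1,8); (4,9); (9,12); (5,10); (10,11);
      (11,15); (14,15); (12,14); (12,13); (11,13); (14,17); (13,16); (15,18);
      (9,10)].

Lemma B11_valid : all valid_pair B11_edges. Proof. by []. Qed.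
Lemma B12_valid : all valid_pair B12_edges. Proof. by []. Qed.

Definition B11 : sgraph 'I_19 := SGraph (edges_ofP B11_valid).
Definition B12 : sgraph 'I_19 := SGraph (edges_ofP B12_valid).

(* Main.v *)
(** Necessity: the graph is cubic with 27 edges, so 3 divides [n - 1] and 27
    divides [n (n - 1) / 2]; hence [n] is prime to 3 and 27 divides [n - 1].

    Sufficiency, for [n = 27 t + 1]: the vertices are a point at infinity and [t]
    groups Z_3 x Z_9; each group together with infinity carries a design of order
    28.  If [t] is odd, the Bose triples [(c - d, l), (c + d, l), (c, l + 1)] of
    Z_t x Z_3, with [1 <= d <= (t - 1) / 2], contain each pair of points from
    distinct groups exactly once; replacing every point by 9 vertices turns a
    triple into a K_{9,9,9}, which decomposes.  If [t >= 4] is even, use the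
    triples of Z_{t-1} x Z_3 and one extra group W.  The edges to W are absorbed
    by the triples with [d = 1]: every point is the first, the second and the
    third point of one such triple each, so a triple only has to take care, for
    each [a] in Z_9 and [w] in W, of the edge from [a] to [w] at one of its three
    points.  The resulting graph with 486 edges decomposes as well.  The orders 28
    and 55, K_{9,9,9} and this graph are handled by explicit base blocks. *)

Require Import Defs.
From mathcomp Require Import all_boot all_algebra zify.

Set Implicit Arguments.
Unset Strict Implicit.
Unset Printing Implicit Defensive.

(** * Copies of a graph as injective images, and designs from coverings *)

Lemma imset_in_inj (T U : finType) (f : T -> U) (A e1 e2 : {set T}) :
  {in A &, injective f} -> e1 \subset A -> e2 \subset A ->
  f @: e1 = f @: e2 -> e1 = e2.
Proof.
move=> injf /subsetP s1 /subsetP s2 eqf; apply/setP=> x; apply/idP/idP => xe.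
  have: f x \in f @: e2 by rewrite -eqf imset_f.
  by case/imsetP=> y ye /injf -> //; [exact: s1 | exact: s2].
have: f x \in f @: e1 by rewrite eqf imset_f.
by case/imsetP=> y ye /injf -> //; [exact: s2 | exact: s1].
Qed.

Lemma image_esetP (T U : finType) (G : sgraph T) (f : T -> U) :
  {in vset G &, injective f} ->
  forall e, e \in [set f @: e' | e' : {set T} in eset G] ->
  e \subset f @: vset G /\ #|e| = 2.
Proof.
move=> injf _ /imsetP[e /esetP[sub card_e] ->].
rewrite imsetS // card_in_imset //.
by move=> x y xe ye; apply: injf; apply: (subsetP sub).
Qed.

Definition image_graph (T U : finType) (G : sgraph T) (f : T -> U)
  (injf : {in vset G &, injective f}) : sgraph U := SGraph (image_esetP injf).

Lemma isomorphic_image_graph (T U : finType) (G : sgraph T) (f : T -> U)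
  (injf : {in vset G &, injective f}) : isomorphic G (image_graph injf).
Proof.
exists f; split=> // x y xG yG /=; rewrite -imset_set1 -imset_set1 -imsetU.
apply/idP/imsetP => [xyG | [e eG /(imset_in_inj injf) -> //]].
- by exists [set x; y].
- by rewrite subUset !sub1set xG.
- by case: (esetP eG).
Qed.

Lemma isomorphic_eset (T U : finType) (G : sgraph T) (H : sgraph U) :
  isomorphic G H -> exists f : T -> U,
  [/\ {in vset G &, injective f}, f @: vset G = vset H
    & eset H = [set f @: e | e : {set T} in eset G]].
Proof.
case=> f [injf imf adjf]; exists f; split=> //; apply/setP=> e.
apply/idP/imsetP=> [eH | [e' eG ->]].
  have [] := esetP eH; rewrite -imf => sub /eqP/cards2P[u [v] [_ def_e]].
  move: sub; rewrite def_e subUset !sub1set.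
  case/andP=> /imsetP[x xG defu] /imsetP[y yG defv].
  exists [set x; y]; first by rewrite adjf // -defu -defv -def_e.
  by rewrite imsetU !imset_set1 defu defv.
have [sub /eqP/cards2P[x [y] [_ def_e]]] := esetP eG.
move: sub eG; rewrite def_e subUset !sub1set => /andP[xG yG].
by rewrite adjf // imsetU !imset_set1.
Qed.

(* Only coverage has to be checked: by the cardinality bound, a family of copies
   covering all pairs cannot cover any of them twice. *)
Lemma design_of_cover (T V K : finType) (G : sgraph T) (b : K -> T -> V) :
  eset G != set0 ->
  (forall k, {in vset G &, injective (b k)}) ->
  (forall u v, u != v ->
    exists k, exists2 e, e \in eset G & b k @: e = [set u; v]) ->
  #|K| * #|eset G| <= 'C(#|V|, 2) ->
  design_exists G #|V|.
Proof.
move=> G0 injb cov leK.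
pose f k x := enum_rank (b k x).
have injf k : {in vset G &, injective (f k)}.
  by move=> x y xG yG /enum_rank_inj; apply: injb.
pose B k := eset (image_graph (injf k)).
have cardB k : #|B k| <= #|eset G| by apply: leq_imset_card.
exists [set B k | k : K]; split; last first.
  move=> _ /imsetP[k _ ->]; exists (image_graph (injf k)).
  split=> //; last exact: isomorphic_image_graph.
  split; first exact: subsetT.
  by apply/subsetP=> e /(esetP (s := image_graph (injf k)))[_]; rewrite inE => ->.
set P := [set _ | k : K].
have coverP : cover P = eset (complete_graph #|V|).
  apply/eqP; rewrite eqEsubset; apply/andP; split.
    apply/bigcupsP=> _ /imsetP[k _ ->].
    apply/subsetP=> e.
    by move/(esetP (s := image_graph (injf k))) => [_]; rewrite inE => ->.
  apply/subsetP=> e; rewrite inE => /cards2P[u [v] [neq_uv ->]].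
  have [|k [e' eG eqe]] := cov (enum_val u) (enum_val v).
    by apply: contra neq_uv => /eqP/enum_val_inj->.
  apply/bigcupP; exists (B k); first exact: imset_f.
  apply/imsetP; exists e' => //.
  have -> : f k @: e' = enum_rank @: (b k @: e').
    by rewrite -imset_comp; apply: eq_imset.
  by rewrite eqe imsetU !imset_set1 !enum_valK.
rewrite /partition coverP eqxx /=; apply/andP; split.
  (* [leq_card_cover] is an equality exactly for disjoint families, so it is enough that the block
     sizes sum to at most ['C(#|V|, 2)]. *)
  have [le_cov <-] := leq_card_cover P; rewrite eqn_leq le_cov /=.
  rewrite coverP /= card_draws card_ord; apply: leq_trans leK.
  apply: (@leq_trans (\sum_(A in P) #|eset G|)).
    by apply: leq_sum => _ /imsetP[k _ ->].
  by rewrite sum_nat_const leq_mul2r leq_imset_card orbT.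
apply/imsetP=> -[k _ /esym/eqP]; apply/negP; apply: contra G0.
by rewrite /B /= imset_eq0.
Qed.

(** * Copies encoded as lists of vertices *)

(* A copy of a labelled graph is given by the list of the images of 1, ..., 18,
   so the label [k] is found at index [k.-1]. *)
Definition joins (V : eqType) (s : seq (nat * nat)) (b : seq V) (u v : V) : bool :=
  has (fun p => (nth u b p.1.-1, nth u b p.2.-1) \in [:: (u, v); (v, u)]) s.

Definition covered (V : eqType) (s : seq (nat * nat)) (D : seq (seq V)) (u v : V) :=
  has (fun b => joins s b u v) D.

Lemma joins_map (U V : eqType) (g : U -> V) s (b : seq U) u v :
  joins s b u v -> joins s (map g b) (g u) (g v).
Proof.
(* The default is mapped along with the entries, so this holds past the end of [b] as well. *)
have nthg k : nth (g u) (map g b) k = g (nth u b k).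
  have [lt_k | le_k] := ltnP k (size b); first exact: nth_map.
  by rewrite !nth_default ?size_map.
case/hasP=> p sp eqp; apply/hasP; exists p => //; rewrite !nthg.
by move: eqp; rewrite !inE => /orP[] /eqP[-> ->]; rewrite !eqxx ?orbT.
Qed.

Lemma covered_cat (V : eqType) s (D1 D2 : seq (seq V)) u v :
  covered s (D1 ++ D2) u v = covered s D1 u v || covered s D2 u v.
Proof. exact: has_cat. Qed.

Definition copies (K : finType) (U V : eqType) (g : K -> U -> V) (D : seq (seq U)) :=
  [seq map (g k) b | k <- enum K, b <- D].

Lemma size_copies (K : finType) (U V : eqType) (g : K -> U -> V) D :
  size (copies g D) = #|K| * size D.
Proof. by rewrite size_allpairs cardE. Qed.

Lemma covered_copies (K : finType) (U V : eqType) (g : K -> U -> V) s D k u v :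
  covered s D u v -> covered s (copies g D) (g k u) (g k v).
Proof.
case/hasP=> b Db jb; apply/hasP; exists (map (g k) b); last exact: joins_map.
by apply/allpairsP; exists (k, b); rewrite mem_enum.
Qed.

Definition is_block (V : eqType) (b : seq V) := uniq b && (size b == 18).

Lemma is_block_copies (K : finType) (V : eqType) (g : K -> nat -> V) N D :
  (forall k, {in gtn N &, injective (g k)}) ->
  all (fun b => is_block b && all (gtn N) b) D ->
  all (@is_block V) (copies g D).
Proof.
move=> injg /allP okD; apply/allP=> _ /allpairsP[[k b] /= [_ Db ->]].
have /andP[/andP[uniq_b size_b] /allP ltb] := okD b Db.
by rewrite /is_block size_map size_b map_inj_in_uniq ?uniq_b // =>
  x y /ltb ltx /ltb lty; apply: injg.
Qed.

Lemma design_of_blocks (V : finType) s (s_valid : all valid_pair s)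
    (V0 : V) (D : seq (seq V)) :
  0 < size s -> all (@is_block V) D ->
  (forall u v, u != v -> covered s D u v || covered s D v u) ->
  size D * size s <= 'C(#|V|, 2) ->
  design_exists (SGraph (edges_ofP s_valid)) #|V|.
Proof.
move=> s0 okD cov leD.
(* Element 0 of ['I_19] shares index 0 with label 1; injectivity is only asked on [labels18], which
   omits 0. *)
pose b (k : 'I_(size D)) (i : 'I_19) := nth V0 (nth [::] D k) i.-1.
have blk k : is_block (nth [::] D k) || (size D <= k).
  by case: ltnP => [lt_k|_]; rewrite ?orbT // (allP okD) // mem_nth.
have cardG : #|edges_of s| <= size s.
  rewrite /edges_of -(size_map (fun p => [set inord p.1; inord p.2] : {set 'I_19})).
  by rewrite cardsE; apply: card_size.
have nthb (k : 'I_(size D)) u p : p \in s ->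
   (b k (inord p.1) = nth u (nth [::] D k) p.1.-1) /\
   (b k (inord p.2) = nth u (nth [::] D k) p.2.-1).
  move/(allP s_valid) => /and3P[/andP[a0 a1] /andP[c0 c1] _].
  have := blk k; rewrite leqNgt ltn_ord orbF => /andP[_ /eqP szb].
  by rewrite /b !inordK //; split; apply: set_nth_default; rewrite szb -ltnS prednK.
apply: (@design_of_cover _ _ 'I_(size D) _ b) => /=.
- case: s s0 {cov leD cardG nthb} s_valid => // p s _ _.
  by apply/set0Pn; exists [set inord p.1; inord p.2]; rewrite inE map_cons mem_head.
- move=> k i j; rewrite !inE /b => i0 j0 /eqP.
  have := blk k; rewrite leqNgt ltn_ord orbF => /andP[ub /eqP szb].
  rewrite nth_uniq // ?szb; first by move=> /eqP eqij; apply: val_inj => /=; lia.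
  + by have := ltn_ord i; lia.
  by have := ltn_ord j; lia.
- have half u v : covered s D u v ->
     exists k, exists2 e, e \in edges_of s & b k @: e = [set u; v].
    case/hasP=> c Dc /hasP[p sp eqp].
    have lt_c : index c D < size D by rewrite index_mem.
    exists (Ordinal lt_c); exists [set inord p.1; inord p.2].
      by rewrite inE; apply/mapP; exists p.
    have [e1 e2] := nthb (Ordinal lt_c) u p sp.
    rewrite imsetU !imset_set1 e1 e2 /= nth_index //.
    by move: eqp; rewrite !inE => /orP[] /eqP[-> ->] //; rewrite setUC.
  move=> u v /cov/orP[/half // | /half[k [e eG eqe]]].
  by exists k; exists e => //; rewrite eqe setUC.
- by rewrite card_ord; apply: leq_trans leD; rewrite leq_mul2l cardG orbT.
Qed.

(** * Necessity: degree and edge counts *)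

Lemma pair_inord_inj (a b c d : nat) : a < b < 19 -> c < d < 19 ->
  [set inord a; inord b] = [set inord c; inord d] :> {set 'I_19} ->
  (a, b) = (c, d).
Proof.
move=> /andP[ab b19] /andP[cd d19] /setP eqs.
(* Ordered endpoints can be recovered from the set: membership of these four labels already forces
   [a = c] and [b = d]. *)
have := (eqs (inord a), eqs (inord b), eqs (inord c), eqs (inord d)).
by rewrite !inE -!val_eqE /= !inordK; try lia; move=> [[[]]] *; congr pair; lia.
Qed.

Lemma card_edges_of s : all (fun p => p.1 < p.2 < 19) s -> uniq s ->
  #|edges_of s| = size s.
Proof.
move=> /allP ok us; rewrite /edges_of cardsE.
rewrite -(size_map (fun p => [set inord p.1; inord p.2] : {set 'I_19})).
apply/card_uniqP; rewrite map_inj_in_uniq // => -[a b] [c d] /ok ab /ok cd /=.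
exact: pair_inord_inj.
Qed.

Lemma card_edges_at s (x : 'I_19) :
  all (fun p => p.1 < p.2 < 19) s -> uniq s ->
  #|[set e in edges_of s | x \in e]| =
  count (fun p => (p.1 == x :> nat) || (p.2 == x :> nat)) s.
Proof.
move=> ok us; rewrite -size_filter -card_edges_of; last 2 first.
- by apply/allP=> p; rewrite mem_filter => /andP[_ /(allP ok)].
- exact: filter_uniq.
have mem_pair (p : nat * nat) : p \in s ->
    (x \in [set inord p.1; inord p.2]) = (p.1 == x :> nat) || (p.2 == x :> nat).
  move=> /(allP ok) /andP[lt12 lt2].
  rewrite !inE -!val_eqE /= !inordK // ?(ltn_trans lt12) //.
  by rewrite !(eq_sym (x : nat)).
apply: eq_card => e; rewrite !inE; apply/andP/mapP.
  case=> /mapP[p sp ->]; rewrite mem_pair // => px.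
  by exists p; rewrite // mem_filter px.
case=> p; rewrite mem_filter => /andP[px sp] ->.
by rewrite mem_pair // px; split=> //; apply: map_f.
Qed.

Lemma card_complete_edges_at n (v : 'I_n) :
  #|[set e in eset (complete_graph n) | v \in e]| = n.-1.
Proof.
transitivity #|[set [set v; y] | y in [set~ v]]|.
  apply: eq_card => e; rewrite !inE; apply/andP/imsetP.
    case=> /cards2P[x [y] [neq_xy ->]]; rewrite !inE => /orP[]/eqP ->.
      by exists y; rewrite // !inE eq_sym.
    by exists x; rewrite ?inE // setUC.
  by case=> y; rewrite !inE => yv ->; rewrite cards2 (eq_sym v) yv !inE eqxx.
rewrite card_in_imset ?cardsC1 ?card_ord // => y z; rewrite !inE => yv zv.
by move/setP/(_ y); rewrite !inE eqxx orbT (negbTE yv) => /esym/eqP.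
Qed.

(** A vertex of [H] inherits degree [r], while a point outside [vset H] lies on no edge;
    divisibility covers both. *)
Lemma card_edges_at_image (T U : finType) (G : sgraph T) (H : sgraph U) r :
  {in vset G, forall x, #|[set e in eset G | x \in e]| = r} ->
  isomorphic G H ->
  forall y, r %| #|[set e in eset H | y \in e]|.
Proof.
move=> degG /isomorphic_eset[f [injf imf ->]] y.
have [/imsetP[x xG ->] | yH] := boolP (y \in f @: vset G); last first.
  rewrite (_ : [set _ in _ | _] = set0) ?cards0 //; apply/setP=> e; rewrite !inE.
  apply: contraNF yH => /andP[/imsetP[e' eG ->]].
  by apply: (subsetP (imsetS _ _)); case: (esetP eG).
rewrite (_ : [set _ in _ | _] =
             [set f @: e | e : {set T} in [set e in eset G | x \in e]]).
  rewrite card_in_imset ?degG // => e1 e2; rewrite !inE.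
  move=> /andP[e1G _] /andP[e2G _]; apply: (imset_in_inj injf).
    by case: (esetP e1G).
  by case: (esetP e2G).
apply/setP=> e; rewrite !inE; apply/andP/imsetP.
  case=> /imsetP[e' eG ->] xe; exists e' => //; rewrite inE eG /=.
  case/imsetP: xe => z ze /injf -> //.
  by case: (esetP eG) => /subsetP sub _; apply: sub.
by case=> e'; rewrite inE => /andP[eG xe] ->; rewrite !imset_f.
Qed.

(** The [n.-1] edges at [ord0] and all ['C(n, 2)] edges are counted block by block: each block
    contributes a multiple of [r] to the first count and exactly [#|eset G|] to the second. *)
Lemma design_order_dvdn (T : finType) (G : sgraph T) r n :
  {in vset G, forall x, #|[set e in eset G | x \in e]| = r} ->
  0 < n -> design_exists G n -> (r %| n.-1) && (#|eset G| %| 'C(n, 2)).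
Proof.
case: n => // n degG _ [P [partP isoP]]; apply/andP; split.
  rewrite -(card_complete_edges_at (ord0 : 'I_n.+1)) -sum1_card.
  rewrite (eq_bigl (fun e => (e \in eset (complete_graph n.+1)) && (ord0 \in e)));
    last by move=> e; rewrite inE.
  rewrite (set_partition_big_cond _ partP); apply: dvdn_sum => B /isoP[H [_ iso ->]].
  rewrite (eq_bigl (mem [set e in eset H | ord0 \in e])); last by move=> e; rewrite !inE.
  by rewrite sum1_card; apply: card_edges_at_image iso _.
have <- : #|eset (complete_graph n.+1)| = 'C(n.+1, 2) by rewrite card_draws card_ord.
rewrite (card_partition partP); apply: dvdn_sum => B /isoP[H [_ /isomorphic_eset]].
case=> f [injf _ ->] ->; rewrite card_in_imset // => e1 e2 /esetP[s1 _] /esetP[s2 _].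
exact: (imset_in_inj injf s1 s2).
Qed.

Lemma snark_design_order s (s_valid : all valid_pair s) n :
  all (fun p => p.1 < p.2 < 19) s -> uniq s -> size s = 27 ->
  all (fun x => count (fun p => (p.1 == x) || (p.2 == x)) s == 3) (iota 1 18) ->
  0 < n -> design_exists (SGraph (edges_ofP s_valid)) n -> n = 1 %[mod 27].
Proof.
move=> s_ord s_uniq s_size s_cubic n0 /(@design_order_dvdn _ _ 3)-/(_ _ n0).
rewrite /= card_edges_of // s_size bin2; case/(_ _)/andP.
  move=> x; rewrite inE => x0 /=; rewrite card_edges_at //.
  by apply/eqP/(allP s_cubic); rewrite mem_iota x0 /= ltn_ord.
move=> /dvdnP[k nk] d27.
(* [n * n.-1] is even, hence twice the binomial coefficient. *)
have: 27 %| n * n.-1.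
  have even_n : ~~ odd (n * n.-1) by case: n {d27 nk} n0 => // n _; rewrite oddM /= andNb.
  by rewrite -(even_halfK even_n) -mul2n dvdn_mull.
rewrite Gauss_dvdr; last first.
  by rewrite (_ : 27 = 3 ^ 3) // coprimeXl // prime_coprime //; lia.
by case/dvdnP=> q nq; rewrite (_ : n = q * 27 + 1) ?modnMDl //; lia.
Qed.

(** * Bose triples over a cyclic group of odd order *)

Section OddCyclicGroup.

Import GRing.Theory.
Local Open Scope ring_scope.

Variable h : nat.
Local Notation Z := 'I_h.*2.+1.

(** [h.+1] is the inverse of 2 modulo [h.*2.+1], so [x *+ h.+1] is half of [x]. *)
Lemma Zp_odd_half (x : Z) : x *+ h.+1 + x *+ h.+1 = x.
Proof.
rewrite -mulrnDr (_ : (h.+1 + h.+1 = h.*2.+1 + 1)%N); last by lia.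
by rewrite mulrnDr Zp_mulrn; apply: val_inj; rewrite /= modnMl add0n modn_small.
Qed.

Lemma Zp_odd_add_eq0 (x : Z) : x + x = 0 -> x = 0.
Proof. by move=> xx; rewrite -[x]Zp_odd_half -mulrnDl xx mul0rn. Qed.

Lemma Zp_odd_abs (e : Z) : e != 0 ->
  exists2 d : nat, (0 < d <= h)%N & e = inord d \/ e = - inord d.
Proof.
rewrite -val_eqE /= -lt0n => e0; have lt_e := ltn_ord e.
have [le_eh | lt_he] := leqP e h.
  by exists (nat_of_ord e); rewrite ?e0 //; left; rewrite inord_val.
exists (h.*2.+1 - e)%N; first by lia.
right; apply: val_inj => /=; rewrite inordK; last by lia.
by rewrite subKn ?(ltnW lt_e) // modn_small.
Qed.

(* The three points of the Bose triple with parameters [c], [d], [l]. *)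
Definition site (c d : Z) (l : 'I_3) (j : nat) : Z * 'I_3 :=
  match j with 0 => (c - d, l) | 1 => (c + d, l) | _ => (c, l + 1) end.

Definition flip (j : nat) : nat := match j with 0 => 1 | 1 => 0 | _ => j end.

Lemma siteN c d l j : site c (- d) l j = site c d l (flip j).
Proof. by case: j => [|[|j]] //=; rewrite opprK. Qed.

Lemma succ_I3_neq (i : 'I_3) : i + 1 != i.
Proof. by case: i => [[|[|[|]]]]. Qed.

(** The first two points differ since 2d is nonzero in odd order; the third lies on another
    level. *)
Lemma site_inj c d l j1 j2 : d != 0 -> (j1 < 3)%N -> (j2 < 3)%N ->
  site c d l j1 = site c d l j2 -> j1 = j2.
Proof.
move=> d0; have cd : c - d = c + d -> False.
  by move/addrI/esym/eqP; rewrite -addr_eq0 => /eqP/Zp_odd_add_eq0/eqP; apply/negP.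
have ll : l + 1 = l -> False by apply/eqP/succ_I3_neq.
case: j1 => [|[|[|]]] // _; case: j2 => [|[|[|]]] // _.
all: move/eqP; rewrite xpair_eqE => /andP[/eqP E1 /eqP E2]; exfalso.
all: by first [exact: cd E1 | exact: cd (esym E1) | exact: ll E2 | exact: ll (esym E2)].
Qed.

(** With [d = 1] this supplies the triple that absorbs an edge from [p] to W at position [j]. *)
Lemma site_onto d j p : exists c l, site c d l j = p.
Proof.
case: p => x i; case: j => [|[|j]] /=.
- by exists (x + d), i; rewrite addrK.
- by exists (x - d), i; rewrite subrK.
- by exists x, (i - 1); rewrite subrK.
Qed.

(** On a common level, [c] is the midpoint and [d] half the difference. Otherwise one level is the
    successor of the other, as there are only three, and the point on the successor level is the
    third of the triple. *)
Lemma site_pair (x y : Z) (i1 i2 : 'I_3) : x != y ->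
  exists c d l j1 j2, [/\ (0 < d <= h)%N, (j1 < 3)%N, (j2 < 3)%N, j1 != j2
    & site c (inord d) l j1 = (x, i1) /\ site c (inord d) l j2 = (y, i2)].
Proof.
move=> neq_xy.
(* The sign of [e] is free: negating it only exchanges the first two positions. *)
suff [c [e [l [j1 [j2 [e0 lt1 lt2 neq12 [def1 def2]]]]]]] :
    exists c e l j1 j2, [/\ e != 0, (j1 < 3)%N, (j2 < 3)%N, j1 != j2
      & site c e l j1 = (x, i1) /\ site c e l j2 = (y, i2)].
  have [d d_lt [|] def_e] := Zp_odd_abs e0; rewrite def_e in def1 def2.
    by exists c, d, l, j1, j2; split.
  rewrite !siteN in def1 def2; exists c, d, l, (flip j1), (flip j2); split=> //.
  - by case: j1 lt1 {def1 neq12} => [|[|[]]].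
  - by case: j2 lt2 {def2 neq12} => [|[|[]]].
  - by move: lt1 lt2 neq12 {def1 def2}; case: j1 => [|[|[]]] //; case: j2 => [|[|[]]].
have [<- | neq_i] := eqVneq i1 i2.
  exists (x *+ h.+1 + y *+ h.+1), (y *+ h.+1 - x *+ h.+1), i1, 0%N, 1%N.
  split=> //=.
    apply: contra neq_xy; rewrite subr_eq0 => /eqP eq_h.
    by rewrite -[x]Zp_odd_half -[y]Zp_odd_half eq_h.
  split; congr pair; first by rewrite opprB addrACA subrr addr0 Zp_odd_half.
  by rewrite addrC addrA subrK Zp_odd_half.
have [<- | neq_i'] := eqVneq (i1 + 1) i2.
  exists y, (y - x), i1, 0%N, 2; split=> //=; first by rewrite subr_eq0 eq_sym.
  by rewrite opprB addrC subrK.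
have <- : i2 + 1 = i1.
  by apply/eqP; move: neq_i neq_i'; case: i1 => [[|[|[|]]]] //; case: i2 => [[|[|[|]]]].
exists x, (x - y), i2, 2, 0%N; split=> //=; first by rewrite subr_eq0.
by rewrite opprB (addrC x) subrK.
Qed.

End OddCyclicGroup.

(** * Templates and their finite coverage checks *)

Definition is_template (N : nat) (D : seq (seq nat)) : bool :=
  all (fun b => is_block b && all (gtn N) b) D.

Definition all_pairs_below (N : nat) (R : nat -> nat -> bool) : bool :=
  all (fun u => all (R u) (iota 0 N)) (iota 0 N).

Lemma all_pairs_belowP N R u v :
  all_pairs_below N R -> u < N -> v < N -> R u v.
Proof.
move=> /allP okR ltu ltv.
have /allP okRu : all (R u) (iota 0 N) by apply: okR; rewrite mem_iota.
by apply: okRu; rewrite mem_iota.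
Qed.

Definition covers_complete s N D :=
  all_pairs_below N (fun u v => (u == v) || covered s D u v).

(* The points [9 * j + a] with [j < 3] and [a < 9] are those of K_{9,9,9}. *)
Definition covers_tripartite s D :=
  all_pairs_below 27 (fun u v => (u %/ 9 == v %/ 9) || covered s D u v).

(* The points of the extra group W are [27], ..., [53]; here [j] is the position
   in the triple with [d = 1] that takes care of [a] and [w]. *)
Definition covers_apex s D :=
  all (fun a => all (fun w =>
    has (fun j => covered s D (9 * j + a) w) (iota 0 3)) (iota 27 27)) (iota 0 9).

Lemma covered_tripartite s D j1 j2 (a1 a2 : 'I_9) :
  covers_tripartite s D -> j1 < 3 -> j2 < 3 -> j1 != j2 ->
  covered s D (9 * j1 + a1) (9 * j2 + a2).
Proof.
move=> cD lt1 lt2 neq12; have lta1 := ltn_ord a1; have lta2 := ltn_ord a2.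
by have := @all_pairs_belowP _ _ (9 * j1 + a1) (9 * j2 + a2) cD; lia.
Qed.

(** * Placing templates on groups and triples *)

Section Assembly.

(** [X] indexes the groups and [emb] selects those that the triples use: the identity when the
    number of groups is odd, [Some] when it is even, with [None] left for W. In [V], [None] is
    infinity. *)
Variables (X : finType) (h : nat) (emb : 'I_h.*2.+1 -> X).
Hypothesis emb_inj : injective emb.

Local Notation V := (option (X * 'I_3 * 'I_9)).

Definition fill (x : X) (k : nat) : V :=
  if k < 27 then Some (x, inord (k %/ 9), inord (k %% 9)) else None.

Definition place (c d : 'I_h.*2.+1) (l : 'I_3) (k : nat) : V :=
  let: (x, i) := site c d l (k %/ 9) in Some (emb x, i, inord (k %% 9)).

Lemma fill_inj x : {in gtn 28 &, injective (fill x)}.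
Proof.
move=> k1 k2; rewrite !inE /fill => lt1 lt2.
case: (ltnP k1 27) => ?; case: (ltnP k2 27) => ? //; last by lia.
move/eqP; rewrite /eq_op /= !xpair_eqE -!val_eqE /= !inordK; lia.
Qed.

Lemma fill_onto x i a : fill x (9 * (i : 'I_3) + (a : 'I_9)) = Some (x, i, a).
Proof.
have lti := ltn_ord i; have lta := ltn_ord a.
rewrite /fill (_ : _ < 27); last by lia.
rewrite (_ : _ %/ 9 = i); last by lia.
by rewrite (_ : _ %% 9 = a) ?inord_val //; lia.
Qed.

Lemma place_inj c d l : (d != 0)%R -> {in gtn 27 &, injective (place c d l)}.
Proof.
move=> d0 k1 k2; rewrite !inE /place => lt1 lt2.
case s1: (site _ _ _ _) => [x1 i1]; case s2: (site _ _ _ _) => [x2 i2].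
case=> /emb_inj eqx eqi /eqP; rewrite -val_eqE /= !inordK ?ltn_mod // => /eqP eqm.
have: k1 %/ 9 = k2 %/ 9 by apply: (site_inj (c := c) (l := l) d0); rewrite ?s1 ?s2 ?eqx ?eqi //; lia.
by lia.
Qed.

Lemma place_site c d l j (a : 'I_9) x i : site c d l j = (x, i) ->
  place c d l (9 * j + a) = Some (emb x, i, a).
Proof.
have lta := ltn_ord a => sj; rewrite /place.
rewrite (_ : _ %/ 9 = j); last by lia.
by rewrite (_ : _ %% 9 = a) ?sj ?inord_val //; lia.
Qed.

Lemma inord_neq0 d : 0 < d <= h -> inord d != 0%R :> 'I_h.*2.+1.
Proof. by move=> lt_d; rewrite -val_eqE /= inordK; lia. Qed.

(** Taking [u] and [v] in an option type treats pairs inside a group and pairs with infinity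
    together. *)
Lemma covered_group s D (u v : option ('I_3 * 'I_9)) (x : X) :
  covers_complete s 28 D -> u != v ->
  covered s (copies fill D) (omap (fun p => (x, p.1, p.2)) u)
                            (omap (fun p => (x, p.1, p.2)) v).
Proof.
have onto w : exists2 k, k < 28 & fill x k = omap (fun p => (x, p.1, p.2)) w.
  case: w => [[i a]|]; last by exists 27.
  exists (9 * i + a); last exact: fill_onto.
  by have := ltn_ord i; have := ltn_ord a; lia.
move=> cD neq_uv; have [k1 lt1 def1] := onto u; have [k2 lt2 def2] := onto v.
have := all_pairs_belowP cD lt1 lt2; rewrite -def1 -def2.
case/orP=> [/eqP eqk | ]; last exact: covered_copies.
case/negP: neq_uv; apply/eqP; move: def1 def2; rewrite eqk => ->.
by case: u v => [[i a]|] [[j b]|] //= [-> ->].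
Qed.

End Assembly.

(** * Designs of all admissible orders from templates *)

Section Designs.

Variables (s : seq (nat * nat)) (s_valid : all valid_pair s).
Hypothesis s_size : size s = 27.
Local Notation G := (SGraph (edges_ofP s_valid)).

Lemma trivial_design : design_exists G 1.
Proof.
rewrite -[X in design_exists _ X]card_ord.
apply: (@design_of_blocks _ _ _ (ord0 : 'I_1) [::]) => //; first by rewrite s_size.
by move=> u v; rewrite !ord1.
Qed.

Lemma complete_design N D : is_template N.+1 D -> covers_complete s N.+1 D ->
  size D * 27 <= 'C(N.+1, 2) -> design_exists G N.+1.
Proof.
move=> okD cD leD; rewrite -[X in design_exists _ X]card_ord.
pose g (_ : unit) (k : nat) : 'I_N.+1 := inord k.
apply: (@design_of_blocks _ _ _ ord0 (copies g D)).
- by rewrite s_size.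
- apply: is_block_copies okD => -[] k1 k2 lt1 lt2 /(congr1 val) /=.
  by rewrite !inordK.
- move=> u v neq_uv; apply/orP; left.
  rewrite -[u]inord_val -[v]inord_val; apply: (covered_copies g tt).
  have := all_pairs_belowP cD (ltn_ord u) (ltn_ord v).
  by rewrite val_eqE (negbTE neq_uv).
- by rewrite size_copies card_unit mul1n s_size card_ord.
Qed.

Variables D28 D27 : seq (seq nat).
Hypotheses (D28_ok : is_template 28 D28) (D28_cov : covers_complete s 28 D28).
Hypotheses (D27_ok : is_template 27 D27) (D27_cov : covers_tripartite s D27).
(** The edge counts are [14 * 27 = 'C(28, 2)] and [9 * 27 = 3 * 81]. *)
Hypotheses (D28_size : size D28 = 14) (D27_size : size D27 = 9).

Lemma odd_design h : design_exists G (h.*2.+1 * 27).+1.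
Proof.
pose V := option ('I_h.*2.+1 * 'I_3 * 'I_9).
have cardV : #|{: V}| = (h.*2.+1 * 27).+1.
  by rewrite card_option !card_prod !card_ord; lia.
(* ['I_h] starts at 0, so the shift gives [d] from 1 to [h]. *)
pose g (z : 'I_h.*2.+1 * 'I_h * 'I_3) := place id z.1.1 (inord z.1.2.+1) z.2.
rewrite -cardV.
apply: (@design_of_blocks _ _ _ None
  (copies (@fill 'I_h.*2.+1) D28 ++ copies g D27)); first by rewrite s_size.
- rewrite all_cat (is_block_copies (@fill_inj _) D28_ok) /=.
  apply: is_block_copies D27_ok => -[[c d] l].
  by apply: place_inj => //; apply: inord_neq0 => /=; have := ltn_ord d; lia.
- move=> u v neq_uv; apply/orP; left; rewrite covered_cat.
  have same (x : 'I_h.*2.+1) w1 w2 := @covered_group _ s D28 w1 w2 x D28_cov.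
  case: u v neq_uv => [[[x i] a]|] [[[y j] b]|] neq_uv //.
  + have [eq_xy | neq_xy] := eqVneq x y.
      rewrite -{y}eq_xy in neq_uv *.
      by rewrite (same x (Some (i, a)) (Some (j, b))) //; apply: contra neq_uv => /eqP[-> ->].
    have [c [d [l [j1 [j2 [lt_d lt1 lt2 neq12 [s1 s2]]]]]]] := site_pair i j neq_xy.
    have lt_d' : d.-1 < h by lia.
    have := @covered_copies _ _ _ g s _ (c, Ordinal lt_d', l) _ _
      (covered_tripartite a b D27_cov lt1 lt2 neq12).
    rewrite /g /= prednK; last by lia.
    by rewrite (place_site _ _ s1) (place_site _ _ s2) => ->; rewrite orbT.
  + by rewrite (same x (Some (i, a)) None).
  + by rewrite (same y None (Some (j, b))).
- rewrite size_cat !size_copies !card_prod !card_ord D28_size D27_size s_size cardV bin2.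
  (* 14 blocks for each group and 9 for each of the [h.*2.+1 * h * 3] triples. *)
  rewrite [_ * _.-1](_ : _ = ((h.*2.+1 * 14 + h.*2.+1 * h * 3 * 9) * 27).*2) ?doubleK //.
  by rewrite -!muln2 /=; lia.
Qed.

Variable D54 : seq (seq nat).
Hypotheses (D54_ok : is_template 54 D54) (D54_cov : covers_tripartite s D54).
(** [18 * 27] counts the 243 edges of K_{9,9,9} and the 243 pairs of [a] and [w]. *)
Hypotheses (D54_apex : covers_apex s D54) (D54_size : size D54 = 18).

Lemma even_design h : design_exists G (h.*2.+4 * 27).+1.
Proof.
pose Z := 'I_h.+1.*2.+1.
pose V := option (option Z * 'I_3 * 'I_9).
have cardV : #|{: V}| = (h.*2.+4 * 27).+1.
  by rewrite card_option !card_prod card_option !card_ord; lia.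
(* The shift gives [d] from 2 to [h.+1]; the triples with [d = 1] are left to [apex]. *)
pose g (z : Z * 'I_h * 'I_3) := place (@Some Z) z.1.1 (inord z.1.2.+2) z.2.
pose apex (z : Z * 'I_3) k : V :=
  if k < 27 then place (@Some Z) z.1 (inord 1) z.2 k else fill None (k - 27).
have apex_place z k (a : 'I_9) : k < 3 ->
    apex z (9 * k + a) = place (@Some Z) z.1 (inord 1) z.2 (9 * k + a).
  by move=> lt_k; rewrite /apex ifT //; have := ltn_ord a; lia.
rewrite -cardV.
pose D := copies (@fill (option Z)) D28 ++ copies g D27 ++ copies apex D54.
apply: (@design_of_blocks _ _ _ None D); first by rewrite s_size.
- rewrite !all_cat (is_block_copies (@fill_inj _) D28_ok) /=; apply/andP; split.
    apply: is_block_copies D27_ok => -[[c d] l].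
    apply: place_inj => [x y [] // |].
    by apply: inord_neq0 => /=; have := ltn_ord d; lia.
  apply: is_block_copies D54_ok => -[c l] k1 k2; rewrite !inE /apex => lt1 lt2.
  have neq k k' : place (@Some Z) c (inord 1) l k = fill None k' -> False.
    by rewrite /place /fill; case: site => x i; case: ifP.
  case: ltnP => ge1; case: ltnP => ge2.
  + by apply: place_inj => //; [move=> x y [] | apply: inord_neq0].
  + by move/neq.
  + by move/esym/neq.
  + by move/fill_inj; rewrite !inE; lia.
- have in_g u v : covered s (copies g D27) u v -> covered s D u v.
    by move=> cov; rewrite /D !covered_cat; apply/or3P; apply: Or32.
  have in_apex u v : covered s (copies apex D54) u v -> covered s D u v.
    by move=> cov; rewrite /D !covered_cat; apply/or3P; apply: Or33.
  have same (x : option Z) w1 w2 := @covered_group _ s D28 w1 w2 x D28_cov.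
  have toW x i (a : 'I_9) i' (a' : 'I_9) :
      covered s D (Some (Some x, i, a)) (Some (None, i', a')).
    have lti' := ltn_ord i'; have lta' := ltn_ord a'.
    have /allP/(_ (27 + (9 * i' + a'))) : all (fun w =>
        has (fun j => covered s D54 (9 * j + a) w) (iota 0 3)) (iota 27 27).
      by apply: (allP D54_apex); rewrite mem_iota /= ltn_ord.
    rewrite mem_iota; case/(_ _)/hasP=> [|j]; first by lia.
    rewrite mem_iota => /andP[_ lt_j] cov_j.
    (* The triple with [d = 1] that has [(x, i)] at the position [j] to which the template assigns
       this edge. *)
    have [c [l s1]] := site_onto (inord 1 : Z) j (x, i).
    have /in_apex := @covered_copies _ _ _ apex s _ (c, l) _ _ cov_j.
    rewrite apex_place // (place_site _ _ s1) /apex ltnNge leq_addr /= addKn.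
    by rewrite fill_onto.
  move=> u v neq_uv.
  case: u v neq_uv => [[[x i] a]|] [[[y j] b]|] neq_uv //.
  + have [eq_xy | neq_xy] := eqVneq x y.
      rewrite -{y}eq_xy in neq_uv *; rewrite /D covered_cat.
      by rewrite (same x (Some (i, a)) (Some (j, b))) //; apply: contra neq_uv => /eqP[-> ->].
    (* If exactly one point is in W, [toW] applies, because the goal accepts either order of the
       pair. *)
    case: x y neq_xy {neq_uv} => [x|] [y|] neq_xy //; try by rewrite toW ?orbT.
    have {}neq_xy : x != y by apply: contra neq_xy => /eqP->.
    have [c [d [l [j1 [j2 [lt_d lt1 lt2 neq12 [s1 s2]]]]]]] := site_pair i j neq_xy.
    have [eq_d | neq_d] := eqVneq d 1.
      rewrite {d lt_d}eq_d in s1 s2.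
      have /in_apex := @covered_copies _ _ _ apex s _ (c, l) _ _
        (covered_tripartite a b D54_cov lt1 lt2 neq12).
      by rewrite !apex_place // (place_site _ _ s1) (place_site _ _ s2) => ->.
    have [lt_d' def_d] : d.-2 < h /\ d.-2.+2 = d by move: lt_d neq_d; clear; lia.
    have /in_g := @covered_copies _ _ _ g s _ (c, Ordinal lt_d', l) _ _
      (covered_tripartite a b D27_cov lt1 lt2 neq12).
    by rewrite /g /= def_d (place_site _ _ s1) (place_site _ _ s2) => ->.
  + by rewrite /D !covered_cat (same x (Some (i, a)) None).
  + by rewrite /D !covered_cat (same y None (Some (j, b))).
- rewrite !size_cat !size_copies !card_prod card_option !card_ord.
  rewrite D28_size D27_size D54_size s_size cardV bin2.
  (* 14 blocks for each group, W included, 9 for each triple with [d >= 2] and 18 for each triple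
     with [d = 1]. *)
  rewrite [_ * _.-1](_ : _ = ((h.+1.*2.+2 * 14 + (h.+1.*2.+1 * h * 3 * 9
    + h.+1.*2.+1 * 3 * 18)) * 27).*2) ?doubleK //.
  by rewrite -!muln2 /=; lia.
Qed.

Variable D55 : seq (seq nat).
Hypotheses (D55_ok : is_template 55 D55) (D55_cov : covers_complete s 55 D55).
Hypothesis D55_size : size D55 = 55.

Lemma snark_design_exists n : n = 1 %[mod 27] -> design_exists G n.
Proof.
rewrite (modn_small (isT : 1 < 27)) => n_mod.
have -> : n = (n %/ 27 * 27).+1 by rewrite {1}(divn_eq n 27) n_mod addn1.
have [] := boolP (odd (n %/ 27)); move: (n %/ 27) => t t_odd.
  by rewrite -(odd_double_half t) t_odd; apply: odd_design.
(* For [t = 2] the group Z_{t-1} is trivial and has no triple with [d = 1], so order 55 is treated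
   directly. *)
rewrite -(even_halfK t_odd); case: (t./2) => [|[|h]].
- exact: trivial_design.
- by apply: (complete_design D55_ok D55_cov); rewrite D55_size.
- exact: even_design.
Qed.

End Designs.

(** * Explicit base blocks and the two snarks *)

(* The translates of [b] by Z_m, which acts on each of the intervals
   [j * m, (j + 1) * m). *)
Definition develop (m : nat) (b : seq nat) : seq (seq nat) :=
  [seq [seq k %/ m * m + (k %% m + r) %% m | k <- b] | r <- iota 0 m].

(* The base blocks below were found by simulated annealing. *)
Definition B11_28 : seq (seq nat) :=
  develop 7 [:: 1; 2; 20; 5; 6; 3; 12; 19; 23; 22; 10; 16; 8; 17; 26; 14; 27; 11]
  ++ develop 7 [:: 3; 25; 7; 18; 10; 27; 1; 24; 16; 21; 19; 26; 12; 14; 2; 4; 9; 8].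

(** One base block suffices: its 27 edges realise each of the 27 nonzero differences of Z_55 up to
    sign. *)
Definition B11_55 : seq (seq nat) :=
  develop 55 [:: 32; 20; 31; 26; 53; 30; 19; 7; 17; 6; 13; 46; 48; 18; 42; 8; 25; 45].

Definition B11_27 : seq (seq nat) :=
  develop 9 [:: 15; 8; 12; 26; 6; 2; 24; 25; 5; 17; 13; 19; 0; 11; 22; 10; 23; 7].

Definition B11_54 : seq (seq nat) :=
  develop 9 [:: 29; 25; 19; 12; 1; 16; 3; 4; 24; 20; 13; 0; 23; 27; 21; 7; 15; 48]
  ++ develop 9 [:: 5; 41; 46; 0; 20; 17; 26; 31; 11; 51; 36; 8; 14; 38; 10; 4; 9; 25].

Definition B12_28 : seq (seq nat) :=
  develop 7 [:: 24; 23; 8; 14; 4; 21; 2; 13; 3; 27; 16; 10; 1; 7; 17; 20; 6; 12]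
  ++ develop 7 [:: 13; 3; 25; 9; 11; 27; 8; 23; 20; 18; 21; 16; 6; 22; 14; 4; 17; 5].

Definition B12_55 : seq (seq nat) :=
  develop 55 [:: 21; 45; 40; 7; 6; 30; 29; 33; 42; 53; 48; 13; 0; 50; 44; 46; 27; 19].

Definition B12_27 : seq (seq nat) :=
  develop 9 [:: 26; 13; 6; 20; 11; 24; 5; 14; 8; 25; 16; 12; 1; 3; 18; 23; 15; 7].

Definition B12_54 : seq (seq nat) :=
  develop 9 [:: 26; 47; 22; 9; 14; 33; 20; 7; 18; 46; 21; 39; 11; 16; 6; 36; 0; 23]
  ++ develop 9 [:: 1; 31; 4; 22; 15; 12; 8; 23; 53; 20; 6; 0; 9; 21; 41; 33; 14; 17].

Lemma B11_design n : n = 1 %[mod 27] -> design_exists B11 n.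
Proof.
by apply: (@snark_design_exists _ _ _ B11_28 B11_27 _ _ _ _ _ _ B11_54 _ _ _ _ B11_55);
  vm_compute.
Qed.

Lemma B12_design n : n = 1 %[mod 27] -> design_exists B12 n.
Proof.
by apply: (@snark_design_exists _ _ _ B12_28 B12_27 _ _ _ _ _ _ B12_54 _ _ _ _ B12_55);
  vm_compute.
Qed.

Theorem theorem2 (G : sgraph 'I_19) (hG : G = B11 \/ G = B12)
  (n : nat) (hn : 0 < n) :
  design_exists G n <-> n = 1 %[mod 27].
Proof.
split; case: hG => ->.
- by apply: snark_design_order.
- by apply: snark_design_order.
- exact: B11_design.
- exact: B12_design.
Qed.
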